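(* Let $G$ be a finite simple undirected graph, let $w\in\mathbb{R}^{V(G)}$ with $w\ge 0$, and let $\delta>1$. Then $\alpha_w(G)=\max\{w^\top x : x \text{ solves } \mathrm{LCP}_\delta(G)\}$.
   Context: For a graph $G$ with adjacency matrix $A$ and $\delta>0$, $\mathrm{LCP}_\delta(G)$ is the problem: find $x\in\mathbb{R}^{V(G)}$ with $x\ge0$, $(I+\delta A)x-\mathbf{e}\ge 0$, $x^\top((I+\delta A)x-\mathbf{e})=0$ ($\mathbf{e}$ the all-ones vector). The $w$-weighted independence number is $\alpha_w(G)=\max\{\sum_{i\in S}w_i : S\subset V(G)\text{ independent}\}$. *)

(* Defs.v *)
From HB Require Import structures.
From mathcomp Require Import all_boot all_order all_algebra.
From mathcomp Require Import classical_sets reals.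

Set Implicit Arguments.
Unset Strict Implicit.
Unset Printing Implicit Defensive.

Import Order.TTheory GRing.Theory Num.Theory.

Local Open Scope classical_set_scope.
Local Open Scope ring_scope.

(* Vectors of R^V are finite functions {ffun V -> R} and V x V matrices are
   functions V -> V -> R, so that no enumeration of V is involved. *)

Section Graph.
Variables (R : realType) (V : finType) (e : rel V).

Definition independent (S : {set V}) : bool :=
  [forall i in S, forall j in S, ~~ e i j].

(* The default value 0 does not affect the maximum, whatever the sign of w:
   set0 is independent and has weight 0. *)
Definition alpha (w : {ffun V -> R}) : R :=
  \big[Num.max/0]_(S : {set V} | independent S) \sum_(i in S) w i.

Definition adj (i j : V) : R := (e i j)%:R.

(* The vector (I + delta A) x - e. *)
Definition slack (delta : R) (x : {ffun V -> R}) : {ffun V -> R} :=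
  [ffun i => (\sum_j ((i == j)%:R + delta * adj i j) * x j) - 1].

End Graph.

Definition dotp (R : realType) (V : finType) (u v : {ffun V -> R}) : R :=
  \sum_i u i * v i.

Definition LCP (R : realType) (V : finType) (e : rel V) (delta : R) :
    set {ffun V -> R} :=
  [set x : {ffun V -> R} | [/\ forall i, 0 <= x i,
               forall i, 0 <= slack e delta x i
             & dotp x (slack e delta x) = 0]].

Definition is_max (R : realType) (A : set R) (m : R) : Prop :=
  A m /\ ubound A m.

(* Main.v *)
(** For nonnegative [x], let [d i] be the [x]-mass of the closed neighbourhood
    of [i]. Order the vertices by independent exponential clocks of rates [x i]
    and select those that ring first in their closed neighbourhood: they are
    independent and [i] is selected with probability [x i / d i], whence the
    weighted Caro-Wei bound [\sum_i w i * (x i / d i) <= alpha_w]. If [x] solves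
    the LCP then complementarity and [delta >= 1] give [d i <= 1] on the support
    of [x], so [w^T x <= alpha_w]. Conversely the indicator function of an
    inclusion-maximal independent set solves the LCP, and as [w >= 0] some
    maximal set has weight [alpha_w]. *)
Require Import Defs.
From mathcomp Require Import all_boot all_order all_algebra.
From mathcomp Require Import classical_sets reals.
(* After [classical_sets], whose lemma names would otherwise shadow those for [{set V}]. *)
From mathcomp Require Import finset.

Set Implicit Arguments.
Unset Strict Implicit.

Import Order.TTheory GRing.Theory Num.Theory.

Local Open Scope classical_set_scope.
Local Open Scope ring_scope.

(** * The weighted Caro-Wei bound *)

Section CaroWei.
Variables (R : realType) (V : finType) (e : rel V).
Hypotheses (e_sym : symmetric e) (e_irr : irreflexive e).

Definition nbhd (i : V) : {set V} := [set j | (j == i) || e i j].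

Lemma nbhd_sym (i j : V) : (i \in nbhd j) = (j \in nbhd i).
Proof. by rewrite !inE eq_sym e_sym. Qed.

Lemma nbhd_refl (i : V) : i \in nbhd i.
Proof. by rewrite inE eqxx. Qed.

Lemma independentP (S : {set V}) :
  reflect {in S &, forall i j, ~~ e i j} (independent e S).
Proof.
apply: (iffP forall_inP) => [h i j iS jS|h i iS].
  by have /forall_inP := h i iS; apply.
by apply/forall_inP => j jS; apply: h.
Qed.

Lemma independentU1 (v : V) (I : {set V}) :
  independent e I -> {in I, forall i, i \notin nbhd v} ->
  independent e (v |: I).
Proof.
move=> /independentP hI hv; apply/independentP => i j.
have nbv k : k \in I -> ~~ e v k.
  by move=> /hv; rewrite inE negb_or => /andP[].
rewrite !in_setU1 => /predU1P[->|iI] /predU1P[->|jI].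
- by rewrite e_irr.
- exact: nbv.
- by rewrite e_sym nbv.
- exact: hI.
Qed.

Variables (w x : {ffun V -> R}).
Hypotheses (w_ge0 : forall i, 0 <= w i) (x_ge0 : forall i, 0 <= x i).

Definition nbhd_mass (S : {set V}) (i : V) : R := \sum_(j in S :&: nbhd i) x j.

(** Expected weight of the random selection run on the subgraph induced by [S]. If the mass at [i]
    is 0, so is [x i], and the term vanishes. *)
Definition caro_wei (S : {set V}) : R :=
  \sum_(i in S) w i * (x i / nbhd_mass S i).

Lemma nbhd_mass_ge (S : {set V}) (i : V) : i \in S -> x i <= nbhd_mass S i.
Proof.
move=> iS; rewrite /nbhd_mass (bigD1 i) ?inE ?iS ?eqxx //=.
by rewrite lerDl sumr_ge0.
Qed.

Lemma nbhd_mass_le (S T : {set V}) (i : V) :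
  S \subset T -> nbhd_mass S i <= nbhd_mass T i.
Proof.
move=> sST; rewrite /nbhd_mass [leRHS](big_setID (S :&: nbhd i)) /=.
rewrite (setIidPr (setSI _ sST)).
by rewrite lerDl sumr_ge0.
Qed.

Lemma ratio_nbhd_mass_le (S T : {set V}) (i : V) : S \subset T -> i \in S ->
  x i / nbhd_mass T i <= x i / nbhd_mass S i.
Proof.
move=> sST iS; have [->|xi0] := eqVneq (x i) 0; first by rewrite !mul0r.
have xi_gt0 : 0 < x i by rewrite lt0r xi0 x_ge0.
have dS := lt_le_trans xi_gt0 (nbhd_mass_ge iS).
have dT := lt_le_trans dS (nbhd_mass_le i sST).
by rewrite ler_pM2l // lef_pV2 ?posrE // nbhd_mass_le.
Qed.

(* Condition on the vertex [v] of [S] whose clock rings first. *)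
Lemma caro_wei_average (S : {set V}) :
  (\sum_(v in S) x v) * caro_wei S <=
  \sum_(v in S) x v * (w v + caro_wei (S :\: nbhd v)).
Proof.
pose r i := w i * (x i / nbhd_mass S i).
(* Shrinking [S] to [S :\: nbhd v] only raises the ratios, so those of [S] serve as lower bounds. *)
have step v : v \in S -> x v * (w v + \sum_(i in S :\: nbhd v) r i) <=
    x v * (w v + caro_wei (S :\: nbhd v)).
  move=> vS; apply: ler_wpM2l => //; rewrite lerD2l; apply: ler_sum => i iS.
  by apply: ler_wpM2l => //; apply: ratio_nbhd_mass_le => //; apply: subsetDl.
apply: le_trans (ler_sum _ step) => {step}.
(* Exchange the sums: by symmetry, [i] survives the removal of [nbhd v] iff [v] lies outside
   [nbhd i]. *)
have -> : \sum_(v in S) x v * (w v + \sum_(i in S :\: nbhd v) r i) =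
    \sum_(i in S) x i * w i
    + \sum_(i in S) (\sum_(v in S :\: nbhd i) x v) * r i.
  under eq_bigr do rewrite mulrDr.
  rewrite big_split /=; congr (_ + _).
  under eq_bigr do rewrite mulr_sumr.
  under [RHS]eq_bigr do rewrite mulr_suml.
  rewrite (exchange_big_dep (mem S)) /=; last by move=> v i _ /setDP[].
  apply: eq_bigr => i iS; apply: eq_bigl => v.
  by rewrite !in_setD iS andbT nbhd_sym andbC.
rewrite -big_split /= /caro_wei mulr_sumr; apply: ler_sum => i iS.
(* The mass outside [nbhd i] cancels; what remains is [nbhd_mass S i * r i <= x i * w i], where the
   denominator of [r i] cancels unless it is 0. *)
rewrite (big_setID (nbhd i)) /= -/(nbhd_mass S i) mulrDl lerD2r.
rewrite -/(r i) /r; have [d0|d0] := eqVneq (nbhd_mass S i) 0.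
  by rewrite d0 mul0r mulr_ge0.
by rewrite mulrCA [_ * (x i / _)]mulrC divfK // mulrC.
Qed.

(** Derandomised selection, by induction on [#|S|]: some first vertex [v] does at least as well as
    the average, and it joins the set obtained for [S :\: nbhd v]. *)
Lemma caro_wei_le_independent (S : {set V}) :
  exists I : {set V},
    [/\ I \subset S, independent e I & caro_wei S <= \sum_(i in I) w i].
Proof.
have [n] := ubnP #|S|; elim: n S => // n IH S ltSn.
(* With zero total mass there is no average to take, but then [x] vanishes on [S] and [set0]
   suffices. *)
have [X0|X_neq0] := eqVneq (\sum_(v in S) x v) 0.
  exists (set0 : {set V}); split; first exact: sub0set.
    by apply/independentP => i j; rewrite inE.
  rewrite big_set0 /caro_wei big1 // => i iS.
  have /psumr_eq0P -> // : \sum_(v in S) x v = 0 by [].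
  by rewrite mul0r mulr0.
have X_gt0 : 0 < \sum_(v in S) x v by rewrite lt0r X_neq0 sumr_ge0.
have /set0Pn[v0 v0S] : S != set0.
  by apply: contra_neq X_neq0 => ->; rewrite big_set0.
pose M v := w v + caro_wei (S :\: nbhd v).
have [v vS vmax] := Order.TotalTheory.arg_maxP M v0S.
have {}vS : v \in S := vS.
have leM : caro_wei S <= M v.
  rewrite -(ler_pM2l X_gt0) (le_trans (caro_wei_average S)) // mulr_suml.
  by apply: ler_sum => i iS; apply: ler_wpM2l => //; apply: vmax.
have ltS : (#|S :\: nbhd v| < n)%N.
  rewrite (leq_trans _ (ltSn : (#|S| <= n)%N)) // proper_card //.
  apply/properP; split; first exact: subsetDl.
  by exists v; rewrite // in_setD nbhd_refl.
have [I [sI hI leI]] := IH _ ltS.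
have notnb i : i \in I -> i \notin nbhd v.
  by move=> /(fintype.subsetP sI) /setDP[].
exists (v |: I); split.
- by rewrite subUset sub1set vS (fintype.subset_trans sI) ?subsetDl.
- exact: independentU1.
- rewrite big_setU1 /=; last by apply/negP => /notnb; rewrite nbhd_refl.
  by rewrite (le_trans leM) // lerD2l.
Qed.

End CaroWei.

(** * LCP solutions and independent sets *)

Section Solutions.
Variables (R : realType) (V : finType) (e : rel V).
Hypotheses (e_sym : symmetric e) (e_irr : irreflexive e).

Lemma slackE (delta : R) (x : {ffun V -> R}) (i : V) :
  slack e delta x i = x i + delta * \sum_(j | e i j) x j - 1.
Proof.
rewrite ffunE; congr (_ - 1).
under eq_bigr do rewrite mulrDl -mulrA.
rewrite big_split /= -mulr_sumr; congr (_ + _ * _).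
  rewrite (bigD1 i) //= eqxx mul1r big1 ?addr0 // => j.
  by rewrite eq_sym => /negPf->; rewrite mul0r.
rewrite [RHS]big_mkcond; apply: eq_bigr => j _.
by rewrite /adj; case: (e i j); rewrite ?mul1r ?mul0r.
Qed.

Lemma nbhd_massTE (x : {ffun V -> R}) (i : V) :
  nbhd_mass e x setT i = x i + \sum_(j | e i j) x j.
Proof.
rewrite /nbhd_mass (bigD1 i) ?inE ?eqxx //=; congr (_ + _).
apply: eq_bigl => j; rewrite !inE /=.
by case: eqVneq => //= [->|_]; rewrite ?e_irr ?andbT.
Qed.

Lemma LCP_slack0 (delta : R) (x : {ffun V -> R}) (i : V) :
  LCP e delta x -> x i != 0 -> slack e delta x i = 0.
Proof.
move=> [x0 s0 /psumr_eq0P xs0] xi0; apply/eqP.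
have /eqP := xs0 (fun j _ => mulr_ge0 (x0 j) (s0 j)) i isT.
by rewrite mulf_eq0 (negPf xi0).
Qed.

(** On the support the slack vanishes, so [x i] plus [delta] times the mass of the neighbours is 1;
    replacing [delta] by 1 cannot increase this. *)
Lemma LCP_nbhd_mass_le1 (delta : R) (x : {ffun V -> R}) (i : V) :
  1 <= delta -> LCP e delta x -> x i != 0 ->
  nbhd_mass e x setT i <= 1.
Proof.
move=> d1 xLCP xi0; have := LCP_slack0 xLCP xi0.
rewrite slackE nbhd_massTE => /subr0_eq <-; case: xLCP => x0 _ _.
by rewrite lerD2l ler_peMl // sumr_ge0.
Qed.

Lemma independent_le_alpha (w : {ffun V -> R}) (I : {set V}) :
  independent e I -> \sum_(i in I) w i <= alpha e w.
Proof. by move=> hI; apply: le_bigmax_cond. Qed.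

Lemma alpha_attained (w : {ffun V -> R}) :
  exists2 I : {set V}, independent e I & alpha e w = \sum_(i in I) w i.
Proof.
rewrite /alpha; elim/big_ind: _ => [|a b [I hI ->] [J hJ ->]|I hI].
- exists (set0 : {set V}); last by rewrite big_set0.
  by apply/independentP => i j; rewrite inE.
- by rewrite /Num.max; case: ifP => _; [exists J | exists I].
- by exists I.
Qed.

Lemma dotp_LCP_le_alpha (w x : {ffun V -> R}) (delta : R) :
  (forall i, 0 <= w i) -> 1 <= delta -> LCP e delta x ->
  dotp w x <= alpha e w.
Proof.
move=> w0 d1 xLCP; have [x0 _ _] := xLCP.
have [I [_ hI leI]] := caro_wei_le_independent e_sym e_irr w0 x0 setT.
apply: le_trans (independent_le_alpha w hI); apply: le_trans leI.
rewrite /dotp /caro_wei (eq_bigl _ _ (in_setT (T := V))).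
apply: ler_sum => i _; apply: ler_wpM2l => //.
have [->|xi0] := eqVneq (x i) 0; first by rewrite mul0r.
have d_gt0 : 0 < nbhd_mass e x setT i.
  by rewrite (lt_le_trans _ (nbhd_mass_ge e x0 (in_setT i))) // lt0r xi0 x0.
by rewrite ler_peMr // invf_ge1 // (LCP_nbhd_mass_le1 d1 xLCP).
Qed.

Definition indicator (I : {set V}) : {ffun V -> R} := [ffun i => (i \in I)%:R].

Lemma dotp_indicator (w : {ffun V -> R}) (I : {set V}) :
  dotp w (indicator I) = \sum_(i in I) w i.
Proof.
rewrite /dotp [RHS]big_mkcond; apply: eq_bigr => i _; rewrite ffunE.
by case: (i \in I); rewrite ?mulr1 ?mulr0.
Qed.

(** On [I] the slack is 0, as no neighbour lies in [I]; off [I], maximality provides a neighbour in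
    [I], so the slack is at least [delta - 1]. *)
Lemma LCP_indicator (delta : R) (I : {set V}) : 1 <= delta ->
  maxset (independent e) I -> LCP e delta (indicator I).
Proof.
move=> d1 /maxsetP[hI maxI].
have ind0 i : 0 <= indicator I i by rewrite ffunE ler0n.
have slackI i : i \in I -> slack e delta (indicator I) i = 0.
  move=> iI; rewrite slackE big1 => [|j eij].
    by rewrite ffunE iI mulr0 addr0 subrr.
  rewrite ffunE; case: (boolP (j \in I)) => // jI.
  by have := elimT (independentP _ _) hI i j iI jI; rewrite eij.
split=> [//|i|].
- have [iI|iNI] := boolP (i \in I); first by rewrite slackI.
  have [j jI jN] : exists2 j, j \in I & j \in nbhd e i.
    apply/exists_inP; apply: contraNT iNI; rewrite negb_exists_in.
    move=> /forall_inP nI; rewrite -(maxI (i |: I)) ?setU11 ?subsetUr //.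
    exact: independentU1.
  have eij : e i j.
    by move: jN; rewrite inE => /predU1P[ji|//]; rewrite -ji jI in iNI.
  rewrite slackE (bigD1 j) //= !ffunE jI (negPf iNI) add0r subr_ge0.
  rewrite (le_trans d1) // ler_peMr ?(le_trans ler01 d1) //.
  by rewrite lerDl sumr_ge0.
- rewrite /dotp big1 // => i _; have [iI|iNI] := boolP (i \in I).
    by rewrite slackI // mulr0.
  by rewrite ffunE (negPf iNI) mul0r.
Qed.

End Solutions.

Theorem theorem5p1 (R : realType) (V : finType) (e : rel V)
    (e_sym : symmetric e) (e_irr : irreflexive e)
    (w : {ffun V -> R}) (w_ge0 : forall i, 0 <= w i)
    (delta : R) (delta_gt1 : 1 < delta) :
  is_max [set dotp w x | x in LCP e delta] (alpha e w).
Proof.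
have d1 := ltW delta_gt1; split; last first.
  by move=> _ [x xLCP <-]; apply: (dotp_LCP_le_alpha e_sym e_irr w_ge0 d1).
have [J hJ alphaJ] := alpha_attained e w.
(* An optimal [J] need not be maximal; enlarging it to [I] loses no weight because [w >= 0]. *)
have [I maxI sJI] := maxset_exists hJ.
exists (indicator R I); first exact: LCP_indicator.
rewrite dotp_indicator; apply/le_anti/andP; split.
  by apply: independent_le_alpha; case/maxsetP: maxI.
rewrite alphaJ [leRHS](big_setID J) /= (setIidPr sJI).
by rewrite lerDl sumr_ge0.
Qed.
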